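(* Let $n\ge3$, let $\mathcal L$ be a complete admissible line chart of length $n$ with neutral line $y=2k$ and vertex set $V$, let $V=V_+\sqcup V_0\sqcup V_-$ be the decomposition into the vertices above, on and below the neutral line, with cardinalities $n_+,n_0,n_-$, let $\Delta_H$ be the convex hull of the standard basis vectors $e_v$ ($v\in V$) of $\mathbb R^V\cong\mathbb R^{n+1}$, and let $\Lambda=\{z\in\mathbb R^V:\sum_{v\in V_+}z_v-\sum_{v\in V_-}z_v=0\}$. Then the intersection $\Lambda\cap\Delta_H$ is a convex polytope affinely equivalent to $C^{n_0}(\delta_{n_+-1}\times\delta_{n_--1})$. Moreover, its face lattice equals the poset $P_K$ of admissible line subcharts of $\mathcal L$.
   Context: A complete line chart of length $n$ is given by $\varepsilon\in\{\pm1\}^n$; it is the polygonal path with the $n+1$ vertices $V=\{(n+1-i,\ \varepsilon_i+\varepsilon_{i+1}+\dots+\varepsilon_n):1\le i\le n+1\}$ (so the first vertex is $(0,0)$). A neutral line is a horizontal line $y=2k$ with $k\in\mathbb Z$. A line subchart $\mathcal L'\prec\mathcal L$ is given by a nonempty subset $V'\subseteq V$ of the vertices. With $S'$ the set of $y$-coordinates of the vertices of $\mathcal L'$, the line chart $\mathcal L'$ is admissible (with respect to the neutral line $y=2k$) if either $\min S'<2k<\max S'$ or $\min S'=2k=\max S'$. $P_K$ is the graded poset of all admissible line subcharts $\mathcal L'$ of $\mathcal L$ (with respect to the given neutral line), ordered by inclusion of vertex sets, the rank of $\mathcal L'$ being $|V'|-2$ in the first case of admissibility (a ''wide'' stratum)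 and $|V'|-1$ in the second case (a ''narrow'' stratum). (This rank equals $\delta(n-1)-\dim X(\mathcal L')$, where $X(\mathcal L')$ is the corresponding stratum in the degeneration of generalized Kummer varieties.) The face lattice is the poset of faces ordered by inclusion; its elements other than the empty face are matched with the elements of $P_K$. $\delta_m$ denotes the standard $m$-simplex, and $C^m(Q)$ the $m$-fold (iterated) cone, i.e. pyramid, over a convex polytope $Q$, with $C^0(Q)=Q$. *)

(* Defs.v *)
From mathcomp Require Export all_boot all_order all_algebra.
From mathcomp Require Export boolp classical_sets functions reals convex.

Set Implicit Arguments.
Unset Strict Implicit.
Unset Printing Implicit Defensive.

Import Order.TTheory GRing.Theory Num.Theory.

Local Open Scope classical_set_scope.
Local Open Scope ring_scope.

(* A complete line chart of length n is a sign vector eps.  Indices are shifted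
   by one: eps m (m < n) is the (m+1)-st sign, and i : 'I_n.+1 stands for the
   (i+1)-st vertex, so the last vertex, i = n, is (0, 0). *)
Definition complete_line_chart n (eps : 'I_n -> int) : Prop :=
  forall m, eps m = 1 \/ eps m = -1.

Definition height n (eps : 'I_n -> int) (i : 'I_n.+1) : int :=
  \sum_(m < n | (i <= m)%N) eps m.

Definition vertex n (eps : 'I_n -> int) (i : 'I_n.+1) : int * int :=
  ((n - i)%N%:Z, height eps i).

(* The vertices are pairwise distinct, so a set of vertices is represented by
   the set of their indices, of type {set 'I_n.+1}. *)
Lemma vertex_inj n (eps : 'I_n -> int) : injective (vertex eps).
Proof.
move=> i j [] hij _; apply: val_inj => /=.
by rewrite -(subKn (ltn_ord i : i <= n)%N) hij (subKn (ltn_ord j : j <= n)%N).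
Qed.

Definition heights n (eps : 'I_n -> int) (V : {set 'I_n.+1}) : seq int :=
  [seq height eps i | i <- enum V].

(* The default value 0 is only reached when V is empty. *)
Definition min_height n (eps : 'I_n -> int) (V : {set 'I_n.+1}) : int :=
  \big[Order.min/head 0 (heights eps V)]_(y <- heights eps V) y.

Definition max_height n (eps : 'I_n -> int) (V : {set 'I_n.+1}) : int :=
  \big[Order.max/head 0 (heights eps V)]_(y <- heights eps V) y.

(* All notions below are relative to the neutral line y = 2k. *)
Definition wide n (eps : 'I_n -> int) (k : int) (V : {set 'I_n.+1}) : bool :=
  min_height eps V < 2 * k < max_height eps V.

Definition narrow n (eps : 'I_n -> int) (k : int) (V : {set 'I_n.+1}) : bool :=
  (min_height eps V == 2 * k) && (max_height eps V == 2 * k).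

Definition admissible n (eps : 'I_n -> int) (k : int) (V : {set 'I_n.+1}) : bool :=
  (V != finset.set0) && (wide eps k V || narrow eps k V).

(* The underlying set of P_K; its order is the inclusion of vertex sets. *)
Definition PK n (eps : 'I_n -> int) (k : int) : set {set 'I_n.+1} :=
  [set V | admissible eps k V].

Definition PK_rank n (eps : 'I_n -> int) (k : int) (V : {set 'I_n.+1}) : nat :=
  if wide eps k V then (#|V| - 2)%N else (#|V| - 1)%N.

Definition vertices_above n (eps : 'I_n -> int) (k : int) : {set 'I_n.+1} :=
  finset (fun i => 2 * k < height eps i).

Definition vertices_on n (eps : 'I_n -> int) (k : int) : {set 'I_n.+1} :=
  finset (fun i => height eps i == 2 * k).

Definition vertices_below n (eps : 'I_n -> int) (k : int) : {set 'I_n.+1} :=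
  finset (fun i => height eps i < 2 * k).

Definition convex_hull (R : realType) d (A : set 'rV[R]_d) : set 'rV[R]_d :=
  smallest (@convex_set R 'rV[R]_d) A.

Definition polytope (R : realType) d (P : set 'rV[R]_d) : Prop :=
  exists s : seq 'rV[R]_d, P = convex_hull [set x | x \in s].

Definition affine_set (R : realType) d (A : set 'rV[R]_d) : Prop :=
  forall (x y : 'rV[R]_d) (t : R), A x -> A y -> A (t *: x + (1 - t) *: y).

Definition affine_hull (R : realType) d (A : set 'rV[R]_d) : set 'rV[R]_d :=
  smallest (@affine_set R d) A.

(* A is nonempty and its affine hull has dimension r. *)
Definition has_affine_dim (R : realType) d (A : set 'rV[R]_d) (r : nat) : Prop :=
  exists (x : 'rV[R]_d) (U : {vspace 'rV[R]_d}),
    \dim U = r /\ affine_hull A = [set x + u | u in [set u | u \in U]].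

(* The map need not be injective outside P. *)
Definition affinely_equivalent (R : realType) d e
    (P : set 'rV[R]_d) (Q : set 'rV[R]_e) : Prop :=
  exists (M : 'M[R]_(d, e)) (b : 'rV[R]_e), set_bij P Q (fun x => x *m M + b).

Definition dot (R : realType) d (c x : 'rV[R]_d) : R :=
  \sum_(i < d) c 0 i * x 0 i.

(* c = 0 yields P itself (a = 0) and the empty face (a = 1). *)
Definition face (R : realType) d (P F : set 'rV[R]_d) : Prop :=
  exists (c : 'rV[R]_d) (a : R),
    (forall x, P x -> dot c x <= a) /\ F = P `&` [set x | dot c x = a].

Definition nonempty_faces (R : realType) d (P : set 'rV[R]_d) :
    set (set 'rV[R]_d) :=
  [set F | face P F /\ F !=set0].

(* Convex hull of the standard basis; the standard m-simplex is std_simplex R m,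
   in dimension m + 1. *)
Definition std_simplex (R : realType) m : set 'rV[R]_m.+1 :=
  convex_hull (range (fun i : 'I_m.+1 => delta_mx 0 i : 'rV[R]_m.+1)).

Arguments std_simplex R m : clear implicits.

Definition prod_set (R : realType) d e (P : set 'rV[R]_d) (Q : set 'rV[R]_e) :
    set 'rV[R]_(d + e) :=
  [set row_mx x y | x in P & y in Q].

(* Pyramid: base {0} x Q, apex (1, 0). *)
Definition cone (R : realType) d (Q : set 'rV[R]_d) : set 'rV[R]_(1 + d) :=
  convex_hull ([set row_mx 0 x | x in Q] `|` [set row_mx 1%:M 0]).

Fixpoint iter_cone (R : realType) d (m : nat) (Q : set 'rV[R]_d) :
    set 'rV[R]_(m + d) :=
  match m return set 'rV[R]_(m + d) with
  | 0%N => Q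
  | m'.+1 => cone (@iter_cone R d m' Q)
  end.

Arguments iter_cone {R d} m Q.

Definition Lambda (R : realType) n (eps : 'I_n -> int) (k : int) :
    set 'rV[R]_n.+1 :=
  [set z | \sum_(v in vertices_above eps k) z 0 v
           - \sum_(v in vertices_below eps k) z 0 v = 0].

Arguments Lambda R {n} eps k.

(* The poset P_K is isomorphic to the poset of nonempty faces of P, ordered by
   inclusion, the rank in P_K being the dimension of the face. *)
Definition face_lattice_is_PK (R : realType) n (eps : 'I_n -> int) (k : int)
    d (P : set 'rV[R]_d) : Prop :=
  exists phi : {set 'I_n.+1} -> set 'rV[R]_d,
    [/\ set_bij (PK eps k) (nonempty_faces P) phi,
        forall V W, PK eps k V -> PK eps k W ->
          (V \subset W <-> phi V `<=` phi W)
      & forall V, PK eps k V -> has_affine_dim (phi V) (PK_rank eps k V)].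

(* Main.v *)
From mathcomp Require Import interval_inference.
From mathcomp Require Import ring lra.
Require Import Defs.

(** Write [A] and [B] for the sets of vertices above and below the neutral
    line.  The polytope is the set of points [z] of the standard simplex whose
    coordinates have the same sum over [A] and over [B]; everything about it
    holds for an arbitrary pair of disjoint sets [A], [B] of coordinates, and
    the line chart enters only through the combinatorics of [A] and [B].

    Faces.  If [z] lies in the polytope, then its support meets [A] exactly when
    it meets [B], because both conditions say that the common sum is nonzero.
    Call a nonempty set [V] with this property balanced.  Conversely each
    balanced [V] is the support of some point: spread one unit of mass evenly
    over each of [V :&: A] and [V :&: B], and give mass 1 to the other elements
    of [V] ([balanced_witness]).  The points supported in [V] form a face,
    because the coordinates are nonnegative.  Every nonempty face [F] is of this
    form: since [F] is convex it has a point [w] of largest support, and a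
    linear functional maximal at [w] is constant on all points supported in
    [supp w], as from [w] one can move a little away from any of them
    ([face_eq_coord_face]).  So balanced sets and nonempty faces correspond,
    and inclusions are preserved both ways.

    Dimension.  The same small moves show that the affine hull of the face of
    [V] is cut out of the coordinate subspace of [V] by two linear equations,
    which are independent if [V] meets [A] and [B], and of which one vanishes
    identically if [V] meets neither: the dimension is [#|V| - 2] or
    [#|V| - 1].

    Affine type.  An iterated pyramid over [Q] is the set of points
    [(t, (1 - sum t) x)] with [x] in [Q], [t] nonnegative and [sum t <= 1]
    ([iter_coneE]).  Splitting [z] into its coordinates on, above and below the
    neutral line and doubling the last two groups, which both sum to
    [(1 - sum t) / 2], gives exactly such a point over a product of two
    simplices.

    Charts.  A nonempty set of vertices is admissible precisely when it is
    balanced.  The full vertex set cannot lie on the neutral line, as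
    consecutive heights differ, so neither [A] nor [B] is empty. *)

Set Implicit Arguments.
Unset Strict Implicit.
Unset Printing Implicit Defensive.

Import Order.TTheory GRing.Theory Num.Theory.

Local Open Scope classical_set_scope.
Local Open Scope ring_scope.

(** * Convex sets and convex hulls *)

Lemma convex_setE (R : realType) d (A : set 'rV[R]_d) :
  convex_set A <-> forall x y (t : R), 0 <= t <= 1 -> A x -> A y ->
    A (t *: x + (1 - t) *: y).
Proof.
split=> [cA x y t /andP[t0 t1] Ax Ay|cA x y t].
  have := cA x y (Itv01 t0 t1) (mem_set Ax) (mem_set Ay).
  by move/set_mem.
move=> /set_mem Ax /set_mem Ay; apply/mem_set; apply: cA => //.
by rewrite ge0 le1.
Qed.

Lemma convex_convex_hull (R : realType) d (A : set 'rV[R]_d) :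
  convex_set (convex_hull A).
Proof.
apply/convex_setE => x y t t01 hx hy C [cC AC].
by move/convex_setE: (cC); apply => //; [apply: hx|apply: hy].
Qed.

Lemma convex_hull_min (R : realType) d (A C : set 'rV[R]_d) :
  convex_set C -> A `<=` C -> convex_hull A `<=` C.
Proof. exact: smallest_sub. Qed.

Lemma sub_convex_hull (R : realType) d (A : set 'rV[R]_d) : A `<=` convex_hull A.
Proof. exact: sub_gen_smallest. Qed.

(** Normalised partial sums stay in [C]: appending one more point replaces the
    normalised sum by a point of the segment from it to the new point. *)
Lemma convex_sum (R : realType) d (C : set 'rV[R]_d) (I : eqType) (r : seq I)
    (Q : pred I) (c : I -> R) (p : I -> 'rV[R]_d) :
  convex_set C -> (forall i, Q i -> 0 <= c i) -> (forall i, Q i -> C (p i)) ->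
  \sum_(i <- r | Q i) c i = 1 -> C (\sum_(i <- r | Q i) c i *: p i).
Proof.
move=> /convex_setE cC c0 Cp.
suff H : 0 < \sum_(i <- r | Q i) c i ->
  C ((\sum_(i <- r | Q i) c i)^-1 *: \sum_(i <- r | Q i) c i *: p i).
  by move=> h; move: H; rewrite h invr1 scale1r; apply; rewrite ltr01.
elim: r => [|i r IH]; first by rewrite big_nil ltxx.
rewrite !big_cons; case: ifP => // Qi.
set s := \sum_(j <- r | Q j) c j in IH *.
set v := \sum_(j <- r | Q j) c j *: p j in IH *.
have s0 : 0 <= s by apply: sumr_ge0.
have := c0 _ Qi; have := Cp _ Qi; move: s0.
rewrite le_eqVlt => /predU1P[s0|s0] Cpi ci0 cs.
  (* All weights of the tail vanish, so it cannot be normalised. *)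
  have v0 : v = 0.
    rewrite /v big_seq_cond big1 // => j /andP[jr Qj].
    suff -> : c j = 0 by rewrite scale0r.
    move: s0 => /esym/eqP; rewrite /s psumr_eq0 //.
    by move=> /allP/(_ _ jr); rewrite Qj => /eqP.
  rewrite v0 -s0 !addr0 scalerA mulVf ?scale1r //.
  by move: cs; rewrite -s0 addr0 lt0r => /andP[].
have := cC (p i) (s^-1 *: v) (c i / (c i + s)).
rewrite scalerDr !scalerA [_^-1 * c i]mulrC.
suff -> : (1 - c i / (c i + s)) / s = (c i + s)^-1.
  apply => //; last exact: IH.
  by rewrite divr_ge0 ?(ltW cs) //= ler_pdivrMr // mul1r lerDl ltW.
by field; rewrite !gt_eqF.
Qed.

(** * Standard simplices and iterated pyramids *)

Definition in_std_simplex (R : realType) d (z : 'rV[R]_d) : Prop :=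
  (forall i, 0 <= z 0 i) /\ \sum_i z 0 i = 1.

Lemma std_simplexE (R : realType) m :
  std_simplex R m = [set z | in_std_simplex z].
Proof.
apply/seteqP; split=> [|z [z0 z1]].
  apply: convex_hull_min.
    apply/convex_setE => x y t /andP[t0 t1] [x0 x1] [y0 y1]; split.
      by move=> i; rewrite !mxE addr_ge0 // mulr_ge0 // subr_ge0.
    rewrite (eq_bigr (fun i => t * x 0 i + (1 - t) * y 0 i)).
      by rewrite big_split /= -!mulr_sumr x1 y1 !mulr1 addrC subrK.
    by move=> i _; rewrite !mxE.
  move=> _ [i _ <-]; split=> [j|]; first by rewrite mxE ler0n.
  rewrite (bigD1 i) //= big1 ?mxE ?eqxx ?addr0 // => j /negPf ji.
  by rewrite mxE ji andbF.
rewrite [z]row_sum_delta.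
apply: convex_sum => //; first exact: convex_convex_hull.
by move=> i _; apply: sub_convex_hull; exists i.
Qed.

(** The right-hand side is convex, because the weights [1 - t] of two points
    combine to the weight of the combination; where this weight vanishes, any
    point of [Q] may serve, which is why [Q] has to be nonempty. *)
Lemma coneE (R : realType) d (Q : set 'rV[R]_d) : convex_set Q -> Q !=set0 ->
  cone Q = [set row_mx (t%:M : 'rV[R]_1) ((1 - t) *: x) | t in [set t : R | 0 <= t <= 1] & x in Q].
Proof.
move=> cQ [q Qq]; apply/seteqP; split=> [|_ [t t01 [x Qx <-]]].
  apply: convex_hull_min; last first.
    move=> _ [[x Qx <-]|->].
      by exists 0; rewrite /= ?lexx ?ler01 //; exists x; rewrite // subr0 scale1r raddf0.
    by exists 1; rewrite /= ?lexx ?ler01 //; exists q; rewrite // subrr scale0r.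
  apply/convex_setE => _ _ s s01 [t t01 [x Qx <-]] [u u01 [y Qy <-]].
  move: (s01) (t01) (u01) => /andP[s0 s1] /andP[t0 t1] /andP[u0 u1].
  pose v := s * t + (1 - s) * u.
  have ev : 1 - v = s * (1 - t) + (1 - s) * (1 - u) by rewrite /v; ring.
  have a0 : 0 <= s * (1 - t) by rewrite mulr_ge0 // subr_ge0.
  have b0 : 0 <= (1 - s) * (1 - u) by rewrite mulr_ge0 // subr_ge0.
  have v0 : 0 <= v by rewrite addr_ge0 // mulr_ge0 // subr_ge0.
  exists v; first by rewrite /= v0 -subr_ge0 ev addr_ge0.
  have [e|ne] := eqVneq (1 - v) 0.
    exists q => //; rewrite e scale0r.
    move: e; rewrite ev => /eqP; rewrite paddr_eq0 // => /andP[/eqP ea /eqP eb].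
    rewrite !scale_row_mx !scalerA add_row_mx ea eb !scale0r addr0.
    by rewrite !scale_scalar_mx -raddfD.
  exists (s * (1 - t) / (1 - v) *: x + (1 - s * (1 - t) / (1 - v)) *: y).
    move/convex_setE: cQ; apply => //.
    have v1 : 0 < 1 - v by rewrite lt0r ne ev addr_ge0.
    by rewrite divr_ge0 ?(ltW v1) //= ler_pdivrMr // mul1r ev lerDl.
  rewrite !scale_row_mx !scalerA add_row_mx !scale_scalar_mx -raddfD.
  rewrite scalerDr !scalerA; congr (row_mx _ (_ *: _ + _ *: _)).
    by rewrite mulrCA divff // mulr1.
  by rewrite mulrBr mulr1 mulrCA divff // mulr1 ev; ring.
have -> : row_mx (t%:M : 'rV_1) ((1 - t) *: x) =
    t *: row_mx 1%:M 0 + (1 - t) *: row_mx 0 x.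
  rewrite !scale_row_mx add_row_mx !scaler0 addr0 add0r.
  by rewrite scale_scalar_mx mulr1.
have /convex_setE cC : convex_set (cone Q) by exact: convex_convex_hull.
apply: cC => //.
  by apply: sub_convex_hull; right.
by apply: sub_convex_hull; left; exists x.
Qed.

(** Closed form of an iterated pyramid: [t] collects the heights over the [m]
    successive bases, rescaled so that they become independent parameters. *)
Lemma iter_coneE (R : realType) d m (Q : set 'rV[R]_d) : convex_set Q -> Q !=set0 ->
  iter_cone m Q = [set row_mx t ((1 - \sum_i t 0 i) *: x) |
    t in [set t : 'rV[R]_m | (forall i, 0 <= t 0 i) /\ \sum_i t 0 i <= 1] & x in Q].
Proof.
move=> cQ [q Qq].
elim: m => [|m IH] /=.
  apply/seteqP; split=> [x Qx|_ [t [t0 t1] [x Qx <-]]].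
    exists 0; first by split; [case|rewrite big_ord0 ler01].
    by exists x => //; rewrite big_ord0 subr0 scale1r row_thin_mx.
  by rewrite big_ord0 subr0 scale1r row_thin_mx.
have cm : convex_set (iter_cone m Q).
  by case: m {IH} => [|m] //=; exact: convex_convex_hull.
have nm : iter_cone m Q !=set0.
  rewrite IH; exists (row_mx 0 q); exists 0; last first.
    exists q => //; rewrite big1 ?subr0 ?scale1r // => i _; by rewrite mxE.
  split=> [i|]; first by rewrite mxE.
  by rewrite big1 ?ler01 // => i _; rewrite mxE.
(* The dimensions [1 + (m + d)] and [m.+1 + d] are convertible, hence no cast. *)
have row_mxA1 (s : R) (t : 'rV[R]_m) (x : 'rV[R]_d) :
    row_mx (s%:M : 'rV_1) (row_mx t x) = row_mx (row_mx (s%:M : 'rV_1) t) x.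
  by rewrite row_mxA castmx_id.
have sumT (s : R) (t : 'rV[R]_m) : \sum_i (row_mx (s%:M : 'rV_1) t) 0 i =
    s + \sum_i t 0 i.
  rewrite big_split_ord big_ord1 row_mxEl mxE eqxx mulr1n; congr (_ + _).
  by apply: eq_bigr => i _; rewrite row_mxEr.
have rowT0 (s : R) (t : 'rV[R]_m) : 0 <= s -> (forall i, 0 <= t 0 i) ->
    forall i : 'I_(1 + m), 0 <= row_mx (s%:M : 'rV_1) t 0 i.
  move=> s0 t0 i; case: (split_ordP i) => j ->; rewrite ?row_mxEl ?row_mxEr //.
  by rewrite mxE (ord1 j) mulr1n.
rewrite coneE //; apply/seteqP; split.
  move=> _ [s /andP[s0 s1] [y + <-]]; rewrite {1}IH => -[t [t0 t1] [x Qx <-]].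
  have s1' : 0 <= 1 - s by rewrite subr_ge0.
  rewrite scale_row_mx row_mxA1.
  exists (row_mx s%:M ((1 - s) *: t)).
    split; first by apply: rowT0 => // i; rewrite mxE mulr_ge0.
    rewrite sumT (eq_bigr (fun i => (1 - s) * t 0 i)); last by move=> i _; rewrite mxE.
    by rewrite -mulr_sumr; nra.
  exists x => //; congr row_mx; rewrite scalerA; congr (_ *: _).
  rewrite sumT (eq_bigr (fun i => (1 - s) * t 0 i)); last by move=> i _; rewrite mxE.
  by rewrite -mulr_sumr; ring.
move=> _ [T [T0 T1] [x Qx <-]].
rewrite -[T](@hsubmxK R 1 1 m) in T0 T1 *.
set u := rsubmx _ in T0 T1 *.
rewrite [lsubmx _]mx11_scalar in T0 T1 *.
set s : R := lsubmx _ 0 0 in T0 T1 *.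
have s0 : 0 <= s.
  suff : 0 <= row_mx (s%:M : 'rV_1) u 0 (lshift m (0 : 'I_1)).
    by rewrite row_mxEl mxE mulr1n.
  exact: T0.
have u0 i : 0 <= u 0 i.
  suff : 0 <= row_mx (s%:M : 'rV_1) u 0 (rshift 1 i) by rewrite row_mxEr.
  exact: T0.
rewrite sumT in T1 *.
have su0 : 0 <= \sum_i u 0 i by apply: sumr_ge0.
exists s; first by rewrite /= s0 /=; lra.
have [e|ne] := eqVneq (1 - s) 0.
  have {}e : s = 1 by lra.
  have us0 : \sum_i u 0 i = 0 by lra.
  have u_0 : u = 0.
    apply/rowP => i; rewrite [RHS]mxE; exact: (psumr_eq0P (fun i _ => u0 i) us0).
  case: nm => y Iy; exists y => //.
  rewrite us0 e u_0 addr0 subrr !scale0r -row_mxA1; congr row_mx.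
  by rewrite row_mx0.
have s1 : 0 < 1 - s by rewrite lt0r ne; lra.
exists (row_mx ((1 - s)^-1 *: u) ((1 - \sum_i ((1 - s)^-1 *: u) 0 i) *: x)).
  rewrite IH; exists ((1 - s)^-1 *: u); last by exists x.
  split=> [i|]; first by rewrite mxE mulr_ge0 // invr_ge0 ltW.
  rewrite (eq_bigr (fun i => (1 - s)^-1 * u 0 i)); last by move=> i _; rewrite mxE.
  by rewrite -mulr_sumr ler_pdivrMl // mulr1; lra.
rewrite (eq_bigr (fun i => (1 - s)^-1 * u 0 i)); last by move=> i _; rewrite mxE.
rewrite -mulr_sumr scale_row_mx !scalerA divff // scale1r row_mxA1.
suff -> : (1 - s) * (1 - (1 - s)^-1 * \sum_(i < m) u 0 i) = 1 - (s + \sum_i u 0 i) by [].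
by field.
Qed.

(** * Points of the balanced simplex and their supports *)

Definition balanced_simplex (R : realType) d (A B : {set 'I_d}) : set 'rV[R]_d :=
  [set z | in_std_simplex z /\ \sum_(i in A) z 0 i = \sum_(i in B) z 0 i].

Arguments balanced_simplex R {d} A B.

Definition supp (R : realType) d (z : 'rV[R]_d) : {set 'I_d} :=
  finset (fun i => z 0 i != 0).

(** The sets of coordinates that are supports of points of the balanced
    simplex, see [balanced_supp] and [balanced_witness]. *)
Definition balanced d (A B V : {set 'I_d}) : bool :=
  (V != finset.set0) && ((V :&: A == finset.set0) == (V :&: B == finset.set0)).

Definition coord_face (R : realType) d (A B V : {set 'I_d}) : set 'rV[R]_d :=
  balanced_simplex R A B `&` [set z | supp z \subset V].

Arguments coord_face R {d} A B V.

Lemma suppPn (R : realType) d (z : 'rV[R]_d) (V : {set 'I_d}) :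
  reflect (forall i, i \notin V -> z 0 i = 0) (supp z \subset V).
Proof.
apply: (iffP fintype.subsetP) => [h i iV|h i].
  by apply/eqP; apply: contraNT iV => zi; apply: h; rewrite inE.
by rewrite inE; apply: contraNT => /h ->.
Qed.

Lemma sum_line (R : realType) d (Q : pred 'I_d) (x y : 'rV[R]_d) (s t : R) :
  \sum_(i | Q i) (s *: x + t *: y) 0 i =
  s * (\sum_(i | Q i) x 0 i) + t * (\sum_(i | Q i) y 0 i).
Proof.
by rewrite !mulr_sumr -big_split /=; apply: eq_bigr => i _; rewrite !mxE.
Qed.

(** Here [t] is an arbitrary scalar: points slightly beyond a segment are needed
    to identify faces. *)
Lemma balanced_simplex_line (R : realType) d (A B : {set 'I_d}) (x y : 'rV[R]_d) t :
  balanced_simplex R A B x -> balanced_simplex R A B y ->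
  (forall i, 0 <= (t *: x + (1 - t) *: y) 0 i) ->
  balanced_simplex R A B (t *: x + (1 - t) *: y).
Proof.
move=> [[_ x1] xAB] [[_ y1] yAB] h; split; first split=> //.
  by rewrite sum_line x1 y1 !mulr1 addrC subrK.
by rewrite !sum_line xAB yAB.
Qed.

Lemma convex_balanced_simplex (R : realType) d (A B : {set 'I_d}) :
  convex_set (balanced_simplex R A B).
Proof.
apply/convex_setE => x y t /andP[t0 t1] Px Py.
apply: balanced_simplex_line => // i; rewrite !mxE.
case: Px => -[x0 _] _; case: Py => -[y0 _] _.
by rewrite addr_ge0 // mulr_ge0 // subr_ge0.
Qed.

Lemma sum_supp_eq0 (R : realType) d (z : 'rV[R]_d) (A : {set 'I_d}) :
  (forall i, 0 <= z 0 i) ->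
  (\sum_(i in A) z 0 i == 0) = (supp z :&: A == finset.set0).
Proof.
move=> z0; apply/eqP/eqP => [h|h].
  apply/finset.setP => i; rewrite !inE; apply/negP => /andP[zi iA].
  by move/negP: zi; apply; apply/eqP; exact: (psumr_eq0P _ h).
apply: big1 => i iA; apply/eqP; apply: contraT => zi.
by have := finset.in_set0 i; rewrite -h !inE zi iA.
Qed.

(** The sums over [A] and over [B] agree, and a sum of nonnegative terms
    vanishes exactly when the support avoids the index set. *)
Lemma balanced_supp (R : realType) d (A B : {set 'I_d}) (z : 'rV[R]_d) :
  balanced_simplex R A B z -> balanced A B (supp z).
Proof.
move=> [[z0 z1] zAB]; rewrite /balanced -!sum_supp_eq0 // zAB eqxx andbT.
apply/eqP => h; have : \sum_i z 0 i = 0.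
  apply: big1 => i _; apply/eqP; apply: contraT => zi.
  by have := finset.in_set0 i; rewrite -h inE zi.
by rewrite z1 => /eqP; rewrite oner_eq0.
Qed.

(** The weights [c] give total mass 1 to [V :&: A] and to [V :&: B] when these
    are nonempty, so that the two sums agree for a balanced [V]. *)
Lemma balanced_witness (R : realType) d (A B V : {set 'I_d}) :
  {in A, forall i, i \notin B} -> balanced A B V ->
  exists2 w, balanced_simplex R A B w & supp w = V.
Proof.
move=> dAB /andP[V0 VAB].
pose c i : R := if i \in A then #|V :&: A|%:R^-1
  else if i \in B then #|V :&: B|%:R^-1 else 1.
pose w i := if i \in V then c i else 0.
have c0 i : i \in V -> 0 < c i.
  move=> iV; rewrite /c; case: ifP => iA.
    by rewrite invr_gt0 ltr0n card_gt0; apply/finset.set0Pn; exists i; rewrite inE iV.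
  case: ifP => // iB.
  by rewrite invr_gt0 ltr0n card_gt0; apply/finset.set0Pn; exists i; rewrite inE iV.
have w0 i : 0 <= w i by rewrite /w; case: ifP => // /c0/ltW.
have wi0 i : (w i != 0) = (i \in V).
  by rewrite /w; case: ifP => [/c0/gt_eqF ->|]; rewrite ?eqxx.
have T0 : 0 < \sum_i w i.
  have /finset.set0Pn[i iV] := V0.
  by rewrite (bigD1 i) //= ltr_wpDr ?sumr_ge0 // lt0r wi0 iV w0.
have wA (C : {set 'I_d}) : (forall i, i \in V :&: C -> c i = #|V :&: C|%:R^-1) ->
    \sum_(i in C) w i = (V :&: C != finset.set0)%:R.
  move=> cC; rewrite (eq_bigr (fun i => if i \in V then c i else 0)) //.
  rewrite -big_mkcondr /= (eq_bigl (mem (V :&: C))); last first.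
    by move=> i; rewrite !inE andbC.
  rewrite (eq_bigr (fun=> #|V :&: C|%:R^-1)) // sumr_const -[_ *+ _]mulr_natr.
  case: (eqVneq (V :&: C) finset.set0) => [->|n0]; first by rewrite cards0 mulr0.
  by rewrite mulVf // pnatr_eq0 cards_eq0.
exists (\row_i (w i / \sum_i w i)); last first.
  by apply/finset.setP => i; rewrite inE mxE mulf_eq0 invr_eq0 (gt_eqF T0) orbF wi0.
split; first split.
- by move=> i; rewrite mxE divr_ge0 // ltW.
- rewrite (eq_bigr (fun i => w i / \sum_i w i)); last by move=> i _; rewrite mxE.
  by rewrite -mulr_suml divff // gt_eqF.
have normE (C : {set 'I_d}) : \sum_(i in C) (\row_i (w i / \sum_i w i)) 0 i =
    (\sum_(i in C) w i) / \sum_i w i.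
  by rewrite mulr_suml; apply: eq_bigr => i _; rewrite mxE.
rewrite !normE !wA ?(eqP VAB) //.
  move=> i; rewrite inE /c => /andP[_ iB]; rewrite iB.
  by have /contraTF/(_ iB) -> := dAB i.
by move=> i; rewrite inE /c => /andP[_ ->].
Qed.

(** * Faces of the balanced simplex *)

(** Only finitely many coordinates can become negative, and those that can are
    positive at [w]. *)
Lemma pos_step (R : realType) d (w u : 'rV[R]_d) :
  (forall i, 0 <= w 0 i) -> supp u \subset supp w ->
  exists2 e : R, 0 < e & forall i, 0 <= (w + e *: u) 0 i.
Proof.
move=> w0 /fintype.subsetP uw.
pose b i : R := if u 0 i < 0 then w 0 i / - u 0 i else 1.
(* No step up to [b i] makes the [i]-th coordinate negative; the value 1 is an
   arbitrary bound for coordinates that do not decrease. *)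
exists (\big[Num.min/1]_i b i).
  apply: lt_bigmin => // i _; rewrite /b; case: ifP => // ui.
  rewrite divr_gt0 ?oppr_gt0 // lt0r w0 andbT.
  by have := uw i; rewrite !inE (lt_eqF ui); apply.
move=> i; rewrite !mxE; set e := \big[_/_]_i _.
have e0 : 0 <= e.
  apply: le_bigmin => // j _; rewrite /b; case: ifP => // uj.
  by rewrite divr_ge0 // oppr_ge0 ltW.
have [ui|ui] := ltP (u 0 i) 0; last by rewrite addr_ge0 // mulr_ge0.
have : e <= b i by exact: bigmin_le.
by rewrite /b ui ler_pdivlMr ?oppr_gt0 // mulrN -subr_ge0 opprK.
Qed.

Lemma dot_line (R : realType) d (c x y : 'rV[R]_d) (s t : R) :
  dot c (s *: x + t *: y) = s * dot c x + t * dot c y.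
Proof.
rewrite /dot !mulr_sumr -big_split /=; apply: eq_bigr => i _; rewrite !mxE.
by ring.
Qed.

(** The functional that sums the coordinates outside [V], negated, is
    nonpositive on the simplex and vanishes exactly at the points supported in
    [V]. *)
Lemma face_coord_face (R : realType) d (A B V : {set 'I_d}) :
  face (balanced_simplex R A B) (coord_face R A B V).
Proof.
exists (\row_i - (i \notin V)%:R), 0; split=> [x [[x0 _] _]|].
  apply: sumr_le0 => i _; rewrite mxE mulNr oppr_le0 mulr_ge0 //.
apply/seteqP; split=> x [Px] /= h; split=> //=.
  rewrite /dot big1 // => i _; rewrite mxE.
  have [iV|iV] := boolP (i \in V); first by rewrite oppr0 mul0r.
  by move/suppPn: h => ->; rewrite ?mulr0.
apply/suppPn => i iV; case: Px => -[x0 _] _.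
have : \sum_i (i \notin V)%:R * x 0 i = 0.
  apply/eqP; rewrite -oppr_eq0 -sumrN; apply/eqP; rewrite -[RHS]h.
  apply: eq_bigr => j _.
  by rewrite mxE mulNr.
move/psumr_eq0P => /(_ (fun j _ => mulr_ge0 (ler0n _ _) (x0 j)) i isT).
by rewrite iV mul1r.
Qed.

(** [V] is the largest support of a point [w] of the face.  It contains the
    support of any other point [z] of the face, since the midpoint of [z] and
    [w] has the union of both supports.  Conversely, for [z] supported in [V]
    the segment from [z] to [w] can be prolonged beyond [w], and a functional
    that is maximal at the interior point [w] of a segment is constant on it. *)
Lemma face_eq_coord_face (R : realType) d (A B : {set 'I_d}) (F : set 'rV[R]_d) :
  face (balanced_simplex R A B) F -> F !=set0 ->
  exists2 V, balanced A B V & F = coord_face R A B V.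
Proof.
move=> [c [a [ca ->]]] [z0 [Pz0 cz0]].
set P := balanced_simplex R A B in ca Pz0 *.
pose Q V := `[< exists w, [/\ P w, dot c w = a & supp w = V] >].
have Q0 : Q (supp z0) by apply/asboolP; exists z0.
have [V /asboolP[w [Pw cw <-]] Vmax] := arg_maxnP (fun V : {set 'I_d} => #|V|) Q0.
exists (supp w); first exact: balanced_supp Pw.
have w0 : forall i, 0 <= w 0 i by case: Pw => -[].
apply/seteqP; split=> z [Pz] /= cz; split=> //=.
  have z0' : forall i, 0 <= z 0 i by case: Pz => -[].
  pose m := 2^-1 *: z + (1 - 2^-1) *: w.
  have mi i : (m 0 i == 0) = (z 0 i == 0) && (w 0 i == 0).
    have -> : m 0 i = 2^-1 * (z 0 i + w 0 i) by rewrite !mxE; field.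
    by rewrite mulf_eq0 invr_eq0 pnatr_eq0 /= paddr_eq0.
  have Qm : Q (supp m).
    apply/asboolP; exists m; split=> //.
      apply: (proj1 (convex_setE _) (@convex_balanced_simplex R d A B)) => //.
      by rewrite invr_ge0 ler0n /= invf_le1 ?ltr0n // ler1n.
    by rewrite dot_line cz cw; field.
  have wm : supp w \subset supp m.
    by apply/fintype.subsetP => i; rewrite !inE mi negb_and => ->; rewrite orbT.
  have -> : supp w = supp m.
    by apply/eqP; rewrite eqEcard wm; exact: Vmax Qm.
  by apply/fintype.subsetP => i; rewrite !inE mi negb_and => ->.
have [|e e0 he] := @pos_step R d w (w - z) w0.
  apply/suppPn => i; move/suppPn: cz => zw iw; rewrite !mxE zw // subr0.
  by move: iw; rewrite inE negbK => /eqP.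
(* The prolongation of the segment beyond [w], as an affine combination. *)
have ee : w + e *: (w - z) = (1 + e) *: w + (1 - (1 + e)) *: z.
  by apply/rowP => i; rewrite !mxE; ring.
apply/le_anti; rewrite (ca _ Pz) /=.
have : dot c ((1 + e) *: w + (1 - (1 + e)) *: z) <= a.
  apply: ca; apply: balanced_simplex_line => //; by rewrite -ee.
by rewrite dot_line cw => h; rewrite -(ler_pM2l e0); nra.
Qed.

(** The face of [V] recovers [V], as it contains a point with support [V]. *)
Lemma coord_face_subset (R : realType) d (A B V W : {set 'I_d}) :
  {in A, forall i, i \notin B} -> balanced A B V ->
  (V \subset W <-> coord_face R A B V `<=` coord_face R A B W).
Proof.
move=> dAB bV; split=> [VW z [Pz zV]|h].
  by split=> //=; exact: fintype.subset_trans VW.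
have [w Pw wV] := @balanced_witness R d A B V dAB bV.
have /h [_ /=] : coord_face R A B V w by split; rewrite //= wV.
by rewrite wV.
Qed.

Lemma coord_face_bij (R : realType) d (A B : {set 'I_d}) :
  {in A, forall i, i \notin B} ->
  set_bij [set V | balanced A B V] (nonempty_faces (balanced_simplex R A B))
    (coord_face R A B).
Proof.
move=> dAB; split.
- move=> V /= bV; split; first exact: face_coord_face.
  by have [w Pw wV] := @balanced_witness R d A B V dAB bV; exists w; split; rewrite //= wV.
- move=> V W /set_mem bV /set_mem bW VW; apply/eqP; rewrite finset.eqEsubset.
  by apply/andP; split; apply/(coord_face_subset R _ dAB); rewrite // VW.
- move=> F [fF nF]; have [V bV ->] := face_eq_coord_face fF nF.
  by exists V.
Qed.

(** * Dimensions of the faces *)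

Definition select (R : realType) d m (s : 'I_m -> 'I_d) : 'M[R]_(d, m) :=
  \matrix_(i, j) (i == s j)%:R.

Lemma mul_select (R : realType) d m (s : 'I_m -> 'I_d) (u : 'rV[R]_d) :
  u *m select R s = \row_j u 0 (s j).
Proof.
apply/rowP => j; rewrite !mxE (bigD1 (s j)) //= mxE eqxx mulr1 big1 ?addr0 //.
by move=> i /negPf ij; rewrite mxE ij mulr0.
Qed.

(** Rank-nullity for the map that records the coordinates outside [V] together
    with the values of [M]: surjectivity of [M] on the coordinate subspace of
    [V] makes the combined map surjective. *)
Lemma dim_supported_kernel (R : realType) d (V : {set 'I_d}) m (M : 'M[R]_(d, m)) :
  (forall b, exists2 x : 'rV_d, supp x \subset V & x *m M = b) ->
  exists2 U : {vspace 'rV[R]_d}, \dim U = (#|V| - m)%N &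
    forall u, (u \in U) = (supp u \subset V) && (u *m M == 0).
Proof.
move=> surj.
pose E := select R (fun j : 'I_#|~: V| => enum_val j).
have E0 (u : 'rV_d) : (u *m E == 0) = (supp u \subset V).
  rewrite mul_select; apply/eqP/suppPn => [h i iV|h].
    have iVC : i \in ~: V by rewrite finset.in_setC.
    move/rowP/(_ (enum_rank_in iVC i)): h.
    by rewrite !mxE enum_rankK_in.
  by apply/rowP => j; rewrite !mxE h // -finset.in_setC enum_valP.
pose g := linfun (@mulmxr R 1 _ _ (row_mx E M)).
have gE u : g u = row_mx (u *m E) (u *m M) by rewrite lfunE /= mul_mx_row.
exists (lker g); last by move=> u; rewrite memv_ker gE row_mx_eq0 E0.
have img : limg g = fullv.
  apply/vspaceP => y; rewrite memvf; apply/memv_imgP.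
  pose e := \sum_j lsubmx y 0 j *: (delta_mx 0 (enum_val j) : 'rV[R]_d).
  have [x xV xM] := surj (rsubmx y - e *m M).
  exists (e + x); first exact: memvf.
  rewrite gE !mulmxDl xM addrCA subrr addr0.
  move: xV; rewrite -E0 => /eqP ->; rewrite addr0 -[LHS]hsubmxK; congr row_mx.
  rewrite mul_select [LHS]row_sum_delta; apply/rowP => j.
  rewrite mxE /e !summxE; apply: eq_bigr => i _; rewrite !mxE eqxx /=.
  by rewrite (inj_eq enum_val_inj).
have := limg_ker_dim g fullv; rewrite capfv img !dimvf /dim /= !mul1n.
move/(canRL (addnK _)) ->.
by rewrite subnDA -[X in (X - #|~: V|)%N]card_ord -(cardsC V) addnK.
Qed.

(** The point [w] is relatively interior: for each direction [u] that satisfies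
    the linear equations of the face, the line from [w] in direction [u] passes
    through a second point of the face, hence lies in its affine hull. *)
Lemma affine_hull_coord_face (R : realType) d (A B V : {set 'I_d}) (w : 'rV[R]_d) :
  balanced_simplex R A B w -> supp w = V ->
  affine_hull (coord_face R A B V) = [set w + u | u in [set u | supp u \subset V /\
    \sum_i u 0 i = 0 /\ \sum_(i in A) u 0 i - \sum_(i in B) u 0 i = 0]].
Proof.
move=> Pw wV; apply/seteqP; split.
  have [[_ w1] wAB] := Pw.
  apply: smallest_sub.
    move=> _ _ t [u [uV [u1 uAB]] <-] [v [vV [v1 vAB]] <-].
    exists (t *: u + (1 - t) *: v); last first.
      by rewrite !scalerDr addrACA -scalerDl (addrC t) subrK scale1r.
    split.
      by apply/suppPn => i iV; rewrite !mxE (suppPn _ _ uV) // (suppPn _ _ vV) // !mulr0 addr0.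
    rewrite !sum_line u1 v1 !mulr0 addr0; split=> //.
    by move/subr0_eq: uAB => ->; move/subr0_eq: vAB => ->; rewrite subrr.
  move=> z [[[_ z1] zAB] zV]; exists (z - w); last by rewrite addrC subrK.
  have zwE (C : pred 'I_d) : \sum_(i | C i) (z - w) 0 i =
      \sum_(i | C i) z 0 i - \sum_(i | C i) w 0 i.
    by rewrite -sumrB; apply: eq_bigr => i _; rewrite !mxE.
  rewrite /= !zwE z1 w1 zAB wAB !subrr; split=> //.
  apply/suppPn => i iV; rewrite !mxE (suppPn _ _ zV) //.
  move: iV; rewrite -wV inE negbK => /eqP ->; exact: subrr.
move=> _ [u [uV [u1 uAB]] <-].
have w0 : forall i, 0 <= w 0 i by case: Pw => -[].
have [|e e0 he] := @pos_step R d w u w0; first by rewrite wV.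
have addE (C : pred 'I_d) : \sum_(i | C i) (w + e *: u) 0 i =
    \sum_(i | C i) w 0 i + e * \sum_(i | C i) u 0 i.
  by rewrite -[w]scale1r sum_line mul1r scale1r.
have [[_ w1] wAB] := Pw.
have -> : w + u = e^-1 *: (w + e *: u) + (1 - e^-1) *: w.
  rewrite scalerDr scalerA mulVf ?gt_eqF // scale1r addrAC -scalerDl (addrC e^-1) subrK.
  by rewrite scale1r.
move=> H [aH subH]; apply: aH; apply: subH.
  split; first split; first split=> //.
  - by rewrite addE w1 u1 mulr0 addr0.
  - by rewrite !addE wAB; move/subr0_eq: uAB => ->.
  - apply/suppPn => i iV; rewrite !mxE (suppPn _ _ uV) // mulr0 addr0.
    by move: iV; rewrite -wV inE negbK => /eqP.
by split; rewrite //= wV.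
Qed.

Lemma mx11_eq0 (R : realType) (x : 'M[R]_1) : (x == 0) = (x 0 0 == 0).
Proof.
by apply/eqP/eqP => [->|x0]; [rewrite mxE|apply/matrixP => i j; rewrite !ord1 mxE].
Qed.

(** If [V] meets neither [A] nor [B], the balance equation is void on the
    coordinate subspace of [V], and the total sum is the only condition.
    Otherwise one coordinate in [A] and one in [B] already realise every pair
    of values of the total sum and the difference of sums. *)
Lemma coord_face_dim (R : realType) d (A B V : {set 'I_d}) :
  {in A, forall i, i \notin B} -> balanced A B V ->
  has_affine_dim (coord_face R A B V)
    (if V :&: A == finset.set0 then (#|V| - 1)%N else (#|V| - 2)%N).
Proof.
move=> dAB bV; have [w Pw wV] := @balanced_witness R d A B V dAB bV.
have [_ /eqP VAB] := andP bV.
pose one : 'cV[R]_d := const_mx 1.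
pose s : 'cV[R]_d := \col_i ((i \in A)%:R - (i \in B)%:R).
have mul1 (u : 'rV_d) : (u *m one == 0) = (\sum_i u 0 i == 0).
  have e : (u *m one) 0 0 = \sum_i u 0 i.
    by rewrite mxE; apply: eq_bigr => i _; rewrite mxE mulr1.
  by rewrite mx11_eq0 e.
have mulS (u : 'rV_d) : (u *m s == 0) = (\sum_(i in A) u 0 i - \sum_(i in B) u 0 i == 0).
  have e : (u *m s) 0 0 = \sum_(i in A) u 0 i - \sum_(i in B) u 0 i.
    rewrite mxE [X in _ = X - _]big_mkcond [X in _ = _ - X]big_mkcond -sumrB.
    apply: eq_bigr => i _; rewrite mxE mulrBr.
    by case: (i \in A); case: (i \in B); rewrite ?mulr1 ?mulr0.
  by rewrite mx11_eq0 e.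
case: ifPn => VA.
  have [i iV] : exists i, i \in V by apply/finset.set0Pn; case/andP: bV.
  have [b|U dU memU] := @dim_supported_kernel R d V _ one.
    exists (b 0 0 *: delta_mx 0 i).
      apply/suppPn => j jV; rewrite !mxE eqxx /=.
      by rewrite (_ : (j == i) = false) ?mulr0 //; apply: contraNF jV => /eqP ->.
    rewrite -scalemxAl -rowE; apply/rowP => j; rewrite !mxE mulr1 ord1; by [].
  exists w, U; split=> //; rewrite (affine_hull_coord_face Pw wV).
  congr image; apply/seteqP; split=> u /=; rewrite memU mul1.
    by case=> uV [-> _]; rewrite uV eqxx.
  move=> /andP[uV /eqP u1]; split=> //; split=> //.
  have uC (C : {set 'I_d}) : V :&: C == finset.set0 -> \sum_(i in C) u 0 i = 0.
    move=> /eqP VC; apply: big1 => j jC; move/suppPn: uV; apply.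
    by apply/negP => jV; have := finset.in_set0 j; rewrite -VC inE jV jC.
  by rewrite !uC ?subrr // -VAB.
have [i] := finset.set0Pn _ VA; rewrite inE => /andP[iV iA].
have [j] : exists j, j \in V :&: B by apply/finset.set0Pn; rewrite -VAB.
rewrite inE => /andP[jV jB].
have iB := dAB _ iA.
have jA : j \notin A by apply/negP => /dAB; rewrite jB.
have [b|U dU memU] := @dim_supported_kernel R d V _ (row_mx one s).
  pose b0 := lsubmx b 0 0; pose b1 := rsubmx b 0 0.
  exists (((b0 + b1) / 2) *: delta_mx 0 i + ((b0 - b1) / 2) *: delta_mx 0 j).
    apply/suppPn => l lV; rewrite !mxE.
    have -> : l == i = false by apply: contraNF lV => /eqP ->.
    have -> : l == j = false by apply: contraNF lV => /eqP ->.
    by rewrite andbF !mulr0 addr0.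
  rewrite -[RHS]hsubmxK mul_mx_row; congr row_mx; apply/rowP => l;
    rewrite mulmxDl -!scalemxAl -!rowE ord1 !mxE /b0 /b1 ?mxE.
    by field.
  rewrite iA jB (negPf iB) (negPf jA) /=; by field.
exists w, U; split=> //; rewrite (affine_hull_coord_face Pw wV).
congr image; apply/seteqP; split=> u /=; rewrite memU mul_mx_row row_mx_eq0 mul1 mulS.
  by case=> uV [-> ->]; rewrite uV eqxx.
by move=> /and3P[uV /eqP u1 /eqP uAB].
Qed.

(** * Vertices of the balanced simplex *)

Lemma sum_partition (V : nmodType) d (A B : {set 'I_d}) (F : 'I_d -> V) :
  {in A, forall i, i \notin B} ->
  \sum_i F i = \sum_(i | (i \notin A) && (i \notin B)) F i +
    (\sum_(i in A) F i + \sum_(i in B) F i).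
Proof.
move=> dAB; rewrite (bigID (mem A)) /= [X in _ + X](bigID (mem B)) /=.
rewrite addrA addrC; congr (_ + (_ + _)).
by apply: eq_bigl => i; case: (boolP (i \in A)) => // /dAB/negPf ->.
Qed.

(** The vertices are the basis vectors outside [A] and [B] and the midpoints of
    [e_i], [e_j] with [i] in [A], [j] in [B].  With [s] the common sum of [z]
    over [A] and [B], the product weights [2 z_i z_j / s] on the midpoints have
    the restrictions of [z] to [A] and [B] as marginals; for [s = 0] they vanish,
    and so does [z] on [A] and [B]. *)
Lemma polytope_balanced_simplex (R : realType) d (A B : {set 'I_d}) :
  {in A, forall i, i \notin B} -> polytope (balanced_simplex R A B).
Proof.
move=> dAB.
pose pt (x : 'I_d + 'I_d * 'I_d) : 'rV[R]_d := match x with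
  | inl i => delta_mx 0 i
  | inr ij => 2^-1 *: (delta_mx 0 ij.1 + delta_mx 0 ij.2) end.
pose Q (x : 'I_d + 'I_d * 'I_d) : bool := match x with
  | inl i => (i \notin A) && (i \notin B)
  | inr ij => (ij.1 \in A) && (ij.2 \in B) end.
exists [seq pt x | x <- enum Q]; apply/seteqP; split; last first.
  apply: convex_hull_min; first exact: convex_balanced_simplex.
  have sum_delta (C : pred 'I_d) j : \sum_(i | C i) (delta_mx 0 j : 'rV[R]_d) 0 i = (C j)%:R.
    have [Cj|Cj] := boolP (C j); last first.
      rewrite big1 // => i Ci; rewrite mxE eqxx /=.
      by rewrite (_ : i == j = false) //; apply: contraNF Cj => /eqP <-.
    rewrite (bigD1 j) //= mxE !eqxx big1 ?addr0 // => i /andP[_ /negPf ij].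
    by rewrite mxE ij andbF.
  move=> _ /mapP[x + ->]; rewrite mem_enum unfold_in.
  case: x => [i|[i j]] /= /andP[iA jB].
    split; first split=> [l|]; first by rewrite mxE ler0n.
      by rewrite sum_delta.
    by rewrite !sum_delta (negPf iA) (negPf jB).
  have jA : j \in A = false by apply/negP => /dAB; rewrite jB.
  rewrite scalerDr; split; first split=> [l|].
  - by rewrite !mxE addr_ge0 // mulr_ge0 ?invr_ge0 ?ler0n.
  - by rewrite sum_line !sum_delta /=; field.
  - by rewrite !sum_line !sum_delta iA jB jA (negPf (dAB _ iA)) !mulr0 addr0 add0r.
move=> z [[z0 z1] zAB].
set s := \sum_(i in A) z 0 i in zAB.
have zA i : i \in A -> z 0 i * s / s = z 0 i.
  move=> iA; have [s0|s0] := eqVneq s 0; last by rewrite mulfK.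
  by rewrite (psumr_eq0P _ s0) // !mul0r.
have zB j : j \in B -> s * z 0 j / s = z 0 j.
  move=> jB; have [s0|s0] := eqVneq s 0; last by rewrite mulrC mulKf.
  by rewrite s0 !mul0r; move: s0; rewrite zAB => s0; rewrite (psumr_eq0P _ s0).
pose c (x : 'I_d + 'I_d * 'I_d) : R := match x with
  | inl i => z 0 i
  | inr ij => 2 * (z 0 ij.1 * z 0 ij.2 / s) end.
have s0 : 0 <= s by apply: sumr_ge0.
have -> : z = \sum_(x | Q x) c x *: pt x.
  rewrite big_sumType /= [LHS]row_sum_delta (sum_partition _ dAB); congr (_ + _).
  rewrite (eq_bigr (fun ij => (z 0 ij.1 * z 0 ij.2 / s) *: delta_mx 0 ij.1 +
      (z 0 ij.1 * z 0 ij.2 / s) *: (delta_mx 0 ij.2 : 'rV[R]_d))); last first.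
    move=> [i j] _ /=; rewrite scalerA mulrAC divff ?pnatr_eq0 // mul1r.
    exact: scalerDr.
  rewrite big_split /=; congr (_ + _).
    rewrite -(pair_big (mem A) (mem B)
      (fun i j => (z 0 i * z 0 j / s) *: (delta_mx 0 i : 'rV[R]_d))) /=.
    apply: eq_bigr => i iA; rewrite -scaler_suml -mulr_suml -mulr_sumr -zAB zA //.
  rewrite -(pair_big (mem A) (mem B)
    (fun i j => (z 0 i * z 0 j / s) *: (delta_mx 0 j : 'rV[R]_d))) /=.
  rewrite exchange_big /=; apply: eq_bigr => j jB.
  by rewrite -scaler_suml -mulr_suml -mulr_suml zB.
apply: convex_sum.
- exact: convex_convex_hull.
- by move=> [i|[i j]] _ //=; rewrite mulr_ge0 // divr_ge0 // mulr_ge0.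
- move=> x Qx; apply: sub_convex_hull; apply/mapP; exists x => //.
  by rewrite mem_enum.
rewrite big_sumType /= -[RHS]z1 [RHS](sum_partition _ dAB); congr (_ + _).
rewrite -zAB -/s -mulr_sumr.
rewrite -(pair_big (mem A) (mem B) (fun i j => z 0 i * z 0 j / s)) /=.
suff -> : \sum_(i in A) \sum_(j in B) z 0 i * z 0 j / s = s by ring.
by apply: eq_bigr => i iA; rewrite -mulr_suml -mulr_sumr -zAB zA.
Qed.

(** * Affine equivalence with an iterated pyramid *)

Lemma set_enumeration d (A : {set 'I_d}) m : #|A| = m ->
  exists s : 'I_m -> 'I_d, [/\ injective s, forall j, s j \in A,
    forall i, i \in A -> exists j, s j = i &
    forall (V : nmodType) (F : 'I_d -> V), \sum_(i in A) F i = \sum_j F (s j)].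
Proof.
move=> <-; exists enum_val; split=> [|j|i iA|V F].
- exact: enum_val_inj.
- exact: enum_valP.
- by exists (enum_rank_in iA i); rewrite enum_rankK_in.
- exact: big_enum_val.
Qed.

(** Extension by zero along [s], a right inverse of [select] when [s] is
    injective. *)
Definition spread (R : realType) d m (s : 'I_m -> 'I_d) (t : 'rV[R]_m) : 'rV[R]_d :=
  \row_i \sum_(j | s j == i) t 0 j.

Lemma spread_in (R : realType) d m (s : 'I_m -> 'I_d) (t : 'rV[R]_m) j :
  injective s -> spread s t 0 (s j) = t 0 j.
Proof.
by move=> s_inj; rewrite mxE (big_pred1 j) // => k; rewrite (inj_eq s_inj).
Qed.

Lemma spread_out (R : realType) d m (s : 'I_m -> 'I_d) (t : 'rV[R]_m) i :
  (forall j, s j != i) -> spread s t 0 i = 0.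
Proof. by move=> si; rewrite mxE big_pred0 // => j; rewrite (negPf (si j)). Qed.

(** The coordinates outside [A] and [B] become the pyramid parameters [t].
    Those in [A] and those in [B] each sum to half of [1 - sum t], so after
    doubling both groups are points of simplices scaled by [1 - sum t]. *)
Lemma affinely_equivalent_balanced_simplex (R : realType) d (A B O : {set 'I_d}) p q :
  {in A, forall i, i \notin B} ->
  (forall i, (i \in O) = (i \notin A) && (i \notin B)) ->
  #|A| = p.+1 -> #|B| = q.+1 ->
  affinely_equivalent (balanced_simplex R A B)
    (iter_cone #|O| (prod_set (std_simplex R p) (std_simplex R q))).
Proof.
move=> dAB defO /set_enumeration[sA [injA inA surA sumA]].
move=> /set_enumeration[sB [injB inB surB sumB]].
have [sO [injO inO surO sumO]] := set_enumeration (erefl #|O|).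
have sumz (z : 'rV[R]_d) : \sum_i z 0 i =
    \sum_j z 0 (sO j) + (\sum_(i in A) z 0 i + \sum_(i in B) z 0 i).
  rewrite (sum_partition _ dAB) -sumO; congr (_ + _).
  by apply: eq_bigl => i; rewrite defO.
have simplex_ne m : std_simplex R m (delta_mx 0 0).
  by apply: sub_convex_hull; exists 0.
have cQ : convex_set (prod_set (std_simplex R p) (std_simplex R q)).
  apply/convex_setE => _ _ t t01 [a Pa [b Qb <-]] [a' Pa' [b' Qb' <-]].
  exists (t *: a + (1 - t) *: a').
    by apply: (proj1 (convex_setE _) (@convex_convex_hull R _ _)).
  exists (t *: b + (1 - t) *: b').
    by apply: (proj1 (convex_setE _) (@convex_convex_hull R _ _)).
  by rewrite !scale_row_mx add_row_mx.
have nQ : prod_set (std_simplex R p) (std_simplex R q) !=set0.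
  exists (row_mx (delta_mx 0 0) (delta_mx 0 0)).
  by exists (delta_mx 0 0) => //; exists (delta_mx 0 0).
rewrite iter_coneE //.
pose M := row_mx (select R sO) (row_mx (2 *: select R sA) (2 *: select R sB)).
have mulM (z : 'rV[R]_d) : z *m M + 0 = row_mx (\row_j z 0 (sO j))
    (row_mx (2 *: \row_j z 0 (sA j)) (2 *: \row_j z 0 (sB j))).
  by rewrite addr0 !mul_mx_row -!scalemxAr !mul_select.
exists M, 0; split.
- move=> z [[z0 z1] zAB]; rewrite mulM.
  set s := \sum_(i in A) z 0 i in zAB.
  have s0 : 0 <= s by apply: sumr_ge0.
  have sO1 : \sum_j (\row_j z 0 (sO j)) 0 j = 1 - 2 * s.
    rewrite (eq_bigr (fun j => z 0 (sO j))); last by move=> j _; rewrite mxE.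
    by have := z1; rewrite sumz -zAB -/s; lra.
  exists (\row_j z 0 (sO j)).
    by rewrite /= sO1; split=> [i|]; [rewrite mxE|lra].
  rewrite sO1 (_ : 1 - (1 - 2 * s) = 2 * s); last by ring.
  have norm m (t : 'I_m.+1 -> 'I_d) (C : {set 'I_d}) : (forall j, t j \in C) ->
      \sum_(i in C) z 0 i = s -> \sum_j z 0 (t j) = s ->
      exists2 a, std_simplex R m a & 2 *: \row_j z 0 (t j) = (2 * s) *: a.
    move=> tC sC st; have [e|ne] := eqVneq s 0.
      exists (delta_mx 0 0) => //; rewrite e mulr0 scale0r.
      apply/rowP => j; rewrite !mxE; move: sC; rewrite e => sC.
      by rewrite (psumr_eq0P _ sC) ?mulr0.
    exists (s^-1 *: \row_j z 0 (t j)); last by rewrite scalerA mulfK.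
    rewrite std_simplexE; split=> [j|]; first by rewrite !mxE mulr_ge0 ?invr_ge0.
    rewrite (eq_bigr (fun j => s^-1 * z 0 (t j))); last by move=> j _; rewrite !mxE.
    by rewrite -mulr_sumr st mulVf.
  have [a Pa ->] := norm p sA A inA erefl (esym (sumA _ _)).
  have [b Qb ->] : exists2 b, std_simplex R q b & 2 *: \row_j z 0 (sB j) = (2 * s) *: b.
    by apply: norm inB (esym zAB) _; rewrite -sumB.
  by exists (row_mx a b); [exists a => //; exists b|rewrite scale_row_mx].
- move=> z z' _ _; rewrite !mulM => /eq_row_mx[eO /eq_row_mx[eA eB]].
  have half m (u v : 'rV[R]_m) : 2 *: u = 2 *: v -> u = v.
    by move=> /(congr1 ( *:%R 2^-1)); rewrite !scalerA mulVf ?pnatr_eq0 // !scale1r.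
  apply/rowP => i.
  have [/surA[j <-]|iA] := boolP (i \in A).
    by move/half/rowP/(_ j): eA; rewrite !mxE.
  have [/surB[j <-]|iB] := boolP (i \in B).
    by move/half/rowP/(_ j): eB; rewrite !mxE.
  have /surO[j <-] : i \in O by rewrite defO iA iB.
  by move/rowP/(_ j): eO; rewrite !mxE.
move=> _ [t [t0 t1] [_ [a Pa [b Qb <-]] <-]].
set r := 1 - \sum_i t 0 i.
have r0 : 0 <= r by rewrite subr_ge0.
move: Pa Qb; rewrite !std_simplexE => -[a0 a1] [b0 b1].
pose z := spread sO t + (r / 2) *: (spread sA a + spread sB b).
have zO j : z 0 (sO j) = t 0 j.
  move: (inO j); rewrite defO => /andP[jA jB].
  rewrite mxE spread_in // 2!mxE !spread_out ?addr0 ?mulr0 ?addr0 // => k.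
    by apply: contraNneq jB => <-.
  by apply: contraNneq jA => <-.
have zA j : z 0 (sA j) = r / 2 * a 0 j.
  have jA := inA j.
  rewrite mxE spread_out ?add0r; last first.
    by move=> k; apply: contraTneq (inO k) => ->; rewrite defO jA.
  rewrite 2!mxE spread_in // spread_out ?addr0 // => k.
  by apply: contraNneq (dAB _ jA) => <-.
have zB j : z 0 (sB j) = r / 2 * b 0 j.
  have jB := inB j.
  rewrite mxE spread_out ?add0r; last first.
    by move=> k; apply: contraTneq (inO k) => ->; rewrite defO jB andbF.
  rewrite 2!mxE spread_out ?add0r ?spread_in // => k.
  by apply: contraTneq (inA k) => ->; apply/negP => /dAB; rewrite jB.
have r2 : 0 <= r / 2 by rewrite divr_ge0.
have zsA : \sum_(i in A) z 0 i = r / 2.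
  by rewrite sumA (eq_bigr (fun j => r / 2 * a 0 j)) // -mulr_sumr a1 mulr1.
have zsB : \sum_(i in B) z 0 i = r / 2.
  by rewrite sumB (eq_bigr (fun j => r / 2 * b 0 j)) // -mulr_sumr b1 mulr1.
exists z.
  split; last by rewrite zsA zsB.
  split; last first.
    rewrite sumz zsA zsB (eq_bigr (fun j => t 0 j)) // /r; by field.
  move=> i.
  have [/surA[j <-]|iA] := boolP (i \in A); first by rewrite zA mulr_ge0.
  have [/surB[j <-]|iB] := boolP (i \in B); first by rewrite zB mulr_ge0.
  by have /surO[j <-] : i \in O; [rewrite defO iA iB|rewrite zO].
rewrite mulM scale_row_mx; congr (row_mx _ (row_mx _ _)); apply/rowP => j.
- by rewrite mxE zO.
- by rewrite [LHS]mxE [RHS]mxE [X in 2 * X = _]mxE zA; field.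
- by rewrite [LHS]mxE [RHS]mxE [X in 2 * X = _]mxE zB; field.
Qed.

(** * Admissible subcharts as balanced sets *)

(** Since the head is itself an entry, taking it as the initial value does not
    affect the minimum. *)
Lemma bigmin_head_lt (s : seq int) (a : int) : s != [::] ->
  (\big[Order.min/head 0 s]_(y <- s) y < a) = has (fun y => y < a) s.
Proof.
case: s => // x s _ /=; rewrite big_cons gt_min; case: ltP => //= ax.
elim: s => [|y s IH] /=; first by rewrite big_nil le_gtF.
by rewrite big_cons gt_min IH.
Qed.

Lemma bigmax_head_gt (s : seq int) (a : int) : s != [::] ->
  (a < \big[Order.max/head 0 s]_(y <- s) y) = has (fun y => a < y) s.
Proof.
case: s => // x s _ /=; rewrite big_cons lt_max; case: ltP => //= ax.
elim: s => [|y s IH] /=; first by rewrite big_nil le_gtF.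
by rewrite big_cons lt_max IH.
Qed.

Lemma has_heights n (eps : 'I_n -> int) (p : pred int) (V C : {set 'I_n.+1}) :
  (forall i, (i \in C) = p (height eps i)) ->
  has p (heights eps V) = (V :&: C != finset.set0).
Proof.
move=> defC; apply/hasP/finset.set0Pn => [[_ /mapP[i iV ->] pi]|[i]].
  by exists i; rewrite inE defC pi andbT -mem_enum.
rewrite inE defC => /andP[iV pi]; exists (height eps i) => //.
by apply: map_f; rewrite mem_enum.
Qed.

Lemma heights_nil n (eps : 'I_n -> int) (V : {set 'I_n.+1}) :
  (heights eps V == [::]) = (V == finset.set0).
Proof. by rewrite -size_eq0 size_map -cardE cards_eq0. Qed.

Lemma min_height_lt n (eps : 'I_n -> int) (k : int) (V : {set 'I_n.+1}) :
  V != finset.set0 ->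
  (min_height eps V < 2 * k) = (V :&: vertices_below eps k != finset.set0).
Proof.
rewrite -(heights_nil eps) => /bigmin_head_lt hV; rewrite /min_height hV.
by apply: has_heights => i; rewrite inE.
Qed.

Lemma max_height_gt n (eps : 'I_n -> int) (k : int) (V : {set 'I_n.+1}) :
  V != finset.set0 ->
  (2 * k < max_height eps V) = (V :&: vertices_above eps k != finset.set0).
Proof.
rewrite -(heights_nil eps) => /bigmax_head_gt hV; rewrite /max_height hV.
by apply: has_heights => i; rewrite inE.
Qed.

Lemma min_le_max_height n (eps : 'I_n -> int) (V : {set 'I_n.+1}) :
  min_height eps V <= max_height eps V.
Proof. exact: le_trans (bigmin_le_id _ _ _ _) (bigmax_ge_id _ _ _ _). Qed.

Lemma narrowE n (eps : 'I_n -> int) (k : int) (V : {set 'I_n.+1}) :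
  narrow eps k V = ~~ (min_height eps V < 2 * k) && ~~ (2 * k < max_height eps V).
Proof.
rewrite -!leNgt /narrow; apply/andP/andP => [[/eqP -> /eqP ->]//|[h1 h2]].
have := min_le_max_height eps V => h.
by split; apply/eqP/le_anti; rewrite ?h1 ?h2 ?(le_trans h h2) ?(le_trans h1 h).
Qed.

(** The set is wide when it meets both sides of the neutral line and narrow when
    it meets neither. *)
Lemma admissibleE n (eps : 'I_n -> int) (k : int) :
  admissible eps k = balanced (vertices_above eps k) (vertices_below eps k).
Proof.
apply/funext => V; rewrite /admissible /balanced.
have [->|V0] := eqVneq V finset.set0; first by [].
rewrite narrowE /wide min_height_lt // max_height_gt //.
by case: (_ == _); case: (_ == _).
Qed.

Lemma vertices_above_disjoint n (eps : 'I_n -> int) (k : int) :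
  {in vertices_above eps k, forall i, i \notin vertices_below eps k}.
Proof. by move=> i; rewrite !inE => /ltW; rewrite leNgt. Qed.

(** The last two vertices differ in height by one sign. *)
Lemma not_all_on n (eps : 'I_n -> int) (k : int) : (0 < n)%N ->
  complete_line_chart eps -> ~ forall i, height eps i = 2 * k.
Proof.
case: n eps => // n eps _ heps hk.
have h0 : height eps ord_max = 0.
  by rewrite /height big_pred0 // => m; rewrite leqNgt ltn_ord.
have h1 : height eps (inord n) = eps ord_max.
  rewrite /height (big_pred1 ord_max) // => m; rewrite inordK //.
  by rewrite [RHS]/= -val_eqE /= eqn_leq leq_ord.
by move: (heps ord_max); rewrite -h1 hk -(hk ord_max) h0 => -[].
Qed.

Lemma Lambda_std_simplexE (R : realType) n (eps : 'I_n -> int) (k : int) :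
  Lambda R eps k `&` std_simplex R n =
  balanced_simplex R (vertices_above eps k) (vertices_below eps k).
Proof.
rewrite std_simplexE setIC; apply/seteqP; split=> z [z1 /= zAB]; split=> //=.
  exact: subr0_eq.
by rewrite /Lambda /= zAB subrr.
Qed.

Theorem proposition6p22 (R : realType) (n : nat) (eps : 'I_n -> int) (k : int)
    (hn : (3 <= n)%N) (heps : complete_line_chart eps)
    (hadm : admissible eps k [set: 'I_n.+1]%SET) :
  let np := #|vertices_above eps k| in
  let n0 := #|vertices_on eps k| in
  let nm := #|vertices_below eps k| in
  let P : set 'rV[R]_n.+1 := Lambda R eps k `&` std_simplex R n in
  [/\ polytope P,
      affinely_equivalent P
        (iter_cone n0 (prod_set (std_simplex R np.-1) (std_simplex R nm.-1)))
    & face_lattice_is_PK eps k P].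
Proof.
rewrite /= Lambda_std_simplexE.
have dAB := @vertices_above_disjoint n eps k.
have [A0 B0] : (0 < #|vertices_above eps k|)%N /\ (0 < #|vertices_below eps k|)%N.
  move: hadm; rewrite admissibleE /balanced !finset.setTI !card_gt0 => /andP[_ /eqP AB].
  suff A0 : vertices_above eps k != finset.set0 by rewrite -AB A0.
  apply/negP => A0; apply: (not_all_on (leq_trans _ hn) heps (k := k)) => // i.
  move: (A0); rewrite AB => /eqP/finset.setP/(_ i); rewrite !inE => /negbT.
  move/eqP/finset.setP/(_ i): A0; rewrite !inE => /negbT.
  by rewrite -!leNgt => h1 h2; apply/le_anti; rewrite h1 h2.
split; first exact: polytope_balanced_simplex.
  apply: affinely_equivalent_balanced_simplex => //; rewrite ?prednK //.
  by move=> i; rewrite !inE -!leNgt eq_le.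
exists (coord_face R (vertices_above eps k) (vertices_below eps k)).
rewrite /PK admissibleE; split=> [|V W bV _|V /= bV].
- exact: coord_face_bij.
- exact: coord_face_subset.
have /andP[V0 /eqP VAB] := bV.
have := coord_face_dim R dAB bV.
rewrite /PK_rank /wide min_height_lt // max_height_gt // -VAB andbb.
by case: (_ == _).
Qed.
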